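(* Let $\mathfrak{G}$ be a group and let $Q$ be a finite set of spins, i.e. a finite set with a right action of $\mathfrak{G}$. For $g\in\mathfrak{G}$ let $\operatorname{Fix}(g)=\{q\in Q: qg=q\}$. (a) If there is $q_0\in Q$ such that every nonidentity group element has fixed set $\{q_0\}$, i.e. $\operatorname{Fix}(g)=\{q_0\}$ for every nonidentity $g\in\mathfrak{G}$, then $\chi_\Phi(Q)$ is the evaluation of the chromatic polynomial $\chi_\Phi(\lambda)$ at $\lambda=|Q|$. If this assumption fails, then $\chi_\Phi(Q)$ is not an evaluation of $\chi_\Phi(\lambda)$. (b) If $\mathfrak{G}$ acts regularly on $Q$, then $\chi_\Phi(Q)$ is the evaluation of the zero-free chromatic polynomial $\chi^{\mathrm b}_\Phi(\lambda)$ at $\lambda=|Q|$. If this assumption fails, then $\chi_\Phi(Q)$ is not an evaluation of $\chi^{\mathrm b}_\Phi(\lambda)$. (c) If the action of $\mathfrak{G}$ on $Q$ is trivial, then $\chi_\Phi(Q)=\chi_\Gamma(|Q|)$, the evaluation at $|Q|$ of the chromatic polynomial of the underlying graph $\Gamma$ of $\Phi$. If the action is nontrivial, then $\chi_\Phi(Q)$ is not an evaluation of $\chi_\Gamma(\lambda)$.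
   Context: Graphs have finitely many vertices and may have loops and multiple edges. A $\mathfrak{G}$-gain graph $\Phi=(\Gamma,\phi)$ consists of an underlying graph $\Gamma=(V,E)$ and a gain function $\phi$ assigning to each oriented edge an element of $\mathfrak{G}$, with $\phi(e^{-1})=\phi(e)^{-1}$, where $e^{-1}$ is $e$ with the opposite orientation. A state is any function $s:V\to Q$. An edge $e$ oriented from $v$ to $w$ (possibly $v=w$) is satisfied in $s$ if $s_w=s_v\phi(e)$ and frustrated otherwise. A state is totally frustrated if every edge is frustrated. $\chi_\Phi(Q)$ denotes the number of totally frustrated states of $\Phi$ with spins in $Q$. To say that $\chi_\Phi(Q)$ is an evaluation of a function $\chi(\lambda)$ (one function for each gain graph $\Phi$) means that there is a fixed value $\lambda_0$ such that $\chi_\Phi(Q)=\chi(\lambda_0)$ for every $\mathfrak{G}$-gain graph $\Phi$; it is the evaluation at $|Q|$ if this holds with $\lambda_0=|Q|$. The action of $\mathfrak{G}$ on $Q$ is trivial if every spin is fixed by every group element, and regular if only the identity element has any fixed points. The chromatic polynomial $\chi_\Phi(\lambda)$ is the polynomial whose value at $\lambda=k|\mathfrak{G}|+1$, for each integer $k\ge 0$, is the number of totally frustrated states with spins in $(\mathfrak{G}\times\{1,\dots,k\})\cup\{0\}$, where $\mathfrak{G}$ acts by right multiplication on the first coordinate and fixes $0$. The zero-free chromatic polynomial $\chi^{\mathrm b}_\Phi(\lambda)$ is the polynomial whose value at $\lambda=k|\mathfrak{G}|$ is the number of totally frustrated states with spins in $\mathfrak{G}\times\{1,\dots,k\}$.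 (These counting descriptions are for finite $\mathfrak{G}$. When $E$ is finite, the same polynomials are given, and for arbitrary $\mathfrak{G}$ may be defined, by $\chi_\Phi(\lambda)=\sum_{A\subseteq E}(-1)^{|A|}\lambda^{b(A)}$ and $\chi^{\mathrm b}_\Phi(\lambda)=\sum_{A}(-1)^{|A|}\lambda^{b(A)}$, the second sum being over balanced $A\subseteq E$. Here an edge set is balanced if every simple closed walk in it, loops included, has gain $1$, the gain of a walk being the product of the gains of its edges in order, and $b(A)$ is the number of connected components of the spanning subgraph $(V,A)$ that are balanced, isolated vertices counting as balanced components.) $\chi_\Gamma(\lambda)$ is the usual chromatic polynomial of the graph $\Gamma$ (equal to $0$ if $\Gamma$ has a loop).
   Formalization: In the negative half of (a) it is assumed that Q is nonempty or the group is nontrivial: for Q empty and the group trivial no q_0 exists, yet χ_Φ(Q)=χ_Φ(0) for every gain graph, so the claim fails exactly there. *)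

(* Defs.v *)
From HB Require Import structures.
From mathcomp Require Import all_boot all_order all_algebra finmap.
From mathcomp Require Import boolp classical_sets functions cardinality.

Set Implicit Arguments.
Unset Strict Implicit.
Unset Printing Implicit Defensive.

Import GRing.Theory Num.Theory.

Local Open Scope classical_set_scope.
Local Open Scope ring_scope.

(* Loops and multiple edges are allowed, and there may be infinitely many
   edges.  Each edge is recorded with an arbitrary reference orientation, from
   [end1] to [end2]. *)
Record multigraph := Multigraph {
  vertex : finType;
  edge : choiceType;
  end1 : edge -> vertex;
  end2 : edge -> vertex }.

(* [(e, true)] is [e] in its reference orientation, [(e, false)] its reverse;
   in particular a loop has two distinct orientations. *)
Definition oedge (Gam : multigraph) : Type := (edge Gam * bool)%type.

Section OrientedEdges.
Variable Gam : multigraph.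

Definition source (o : oedge Gam) : vertex Gam :=
  if o.2 then end1 o.1 else end2 o.1.
Definition target (o : oedge Gam) : vertex Gam :=
  if o.2 then end2 o.1 else end1 o.1.
Definition reverse (o : oedge Gam) : oedge Gam := (o.1, ~~ o.2).

Definition adjacent (A : {fset edge Gam}) : rel (vertex Gam) := fun v w =>
  has (fun e => [exists b : bool, (source (e, b) == v) && (target (e, b) == w)])
      A.

(* The edge set of the connected component of [v] in the spanning subgraph
   with edge set [A]. *)
Definition component_edges (A : {fset edge Gam}) (v : vertex Gam) :
    {fset edge Gam} :=
  [fset e in A | connect (adjacent A) v (end1 e)]%fset.

(* No vertex and no edge is repeated; a loop is a walk of length 1. *)
Definition simple_closed_walk (w : seq (oedge Gam)) : bool :=
  [&& path.cycle (fun o1 o2 => target o1 == source o2) w,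
      uniq [seq source o | o <- w] & uniq [seq o.1 | o <- w]].

End OrientedEdges.

Record gain_graph (G : groupType) := GainGraph {
  underlying :> multigraph;
  gain : oedge underlying -> G;
  gain_reverse : forall o, gain (reverse o) = ((gain o)^-1)%g }.

Definition is_right_action (G : groupType) (Q : Type) (act : Q -> G -> Q) :=
  (forall q, act q 1%g = q) /\
  (forall q g h, act q (g * h)%g = act (act q g) h).

Definition Fix (G : groupType) (Q : Type) (act : Q -> G -> Q) (g : G) : set Q :=
  [set q | act q g = q].

(* The cardinality of a finite set ([fset_set] of an infinite set is empty). *)
Definition ncard (T : choiceType) (A : set T) : nat := #|` fset_set A|.

Section States.
Variables (G : groupType) (Q : choiceType) (act : Q -> G -> Q).
Variable Phi : gain_graph G.

Definition satisfied (s : {ffun vertex Phi -> Q}) (o : oedge Phi) : Prop :=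
  s (target o) = act (s (source o)) (gain o).

Definition totally_frustrated : set {ffun vertex Phi -> Q} :=
  [set s | forall o : oedge Phi, ~ satisfied s o].

Definition nb_frustrated : nat := ncard totally_frustrated.

End States.

(* The spin sets G x {1, ..., k} and (G x {1, ..., k}) u {0}, the spin 0 being
   [None]. *)
Definition act_zero_free (G : groupType) (k : nat) (q : G * 'I_k) (g : G) :
  G * 'I_k := ((q.1 * g)%g, q.2).
Definition act_zero (G : groupType) (k : nat) (q : option (G * 'I_k)) (g : G) :
  option (G * 'I_k) := omap (fun q' => act_zero_free q' g) q.

Section ChromaticPolynomials.
Variables (R : numDomainType) (G : groupType).
Implicit Types (Phi : gain_graph G) (p : {poly R}).

Definition balanced Phi (A : {fset edge Phi}) : Prop :=
  forall w : seq (oedge Phi), simple_closed_walk w ->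
    {in w, forall o, o.1 \in A} -> (\prod_(o <- w) gain o)%g = 1%g.

Definition nb_balanced_components Phi (A : {fset edge Phi}) : nat :=
  n_comp (adjacent A) [pred v | `[< balanced (component_edges A v) >]].

(* The two subset expansions; meaningful only when there are finitely many
   edges. *)
Definition chromatic_expansion Phi : {poly R} :=
  \sum_(A <- fpowerset (fset_set [set: edge Phi]))
    (-1) ^+ #|` A| *: 'X^(nb_balanced_components A).

Definition zero_free_expansion Phi : {poly R} :=
  \sum_(A <- fpowerset (fset_set [set: edge Phi]) | `[< balanced A >])
    (-1) ^+ #|` A| *: 'X^(nb_balanced_components A).

(* The chromatic polynomials are defined by counting when the group is finite
   and by the subset expansion when the edge set is finite; they are not
   defined when both are infinite. *)
Definition has_chromatic_poly Phi : Prop :=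
  finite_set [set: G] \/ finite_set [set: edge Phi].

Definition is_chromatic_poly Phi p : Prop :=
  (finite_set [set: G] -> forall k : nat,
     p.[(k * ncard [set: G] + 1)%:R] = (nb_frustrated (@act_zero G k) Phi)%:R)
  /\ (finite_set [set: edge Phi] -> p = chromatic_expansion Phi).

Definition is_zero_free_chromatic_poly Phi p : Prop :=
  (finite_set [set: G] -> forall k : nat,
     p.[(k * ncard [set: G])%:R] =
       (nb_frustrated (@act_zero_free G k) Phi)%:R)
  /\ (finite_set [set: edge Phi] -> p = zero_free_expansion Phi).

(* Under [has_chromatic_poly Phi] each specification determines exactly one
   polynomial, which [xget] selects. *)
Definition chromatic_poly Phi : {poly R} :=
  xget 0 [set p | is_chromatic_poly Phi p].
Definition zero_free_chromatic_poly Phi : {poly R} :=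
  xget 0 [set p | is_zero_free_chromatic_poly Phi p].

Definition proper_coloring (Gam : multigraph) (k : nat) :
    set {ffun vertex Gam -> 'I_k} :=
  [set c | forall e : edge Gam, c (end1 e) <> c (end2 e)].

Definition graph_chromatic_poly (Gam : multigraph) : {poly R} :=
  xget 0 [set p : {poly R} | forall k : nat,
                 p.[k%:R] = (ncard (@proper_coloring Gam k))%:R].

(* [N Phi] is [chi Phi] evaluated at the fixed value [lambda0], for every gain
   graph [Phi] for which [chi] is defined. *)
Definition is_evaluation (N : gain_graph G -> nat)
    (defined : gain_graph G -> Prop) (chi : gain_graph G -> {poly R})
    (lambda0 : R) : Prop :=
  forall Phi, defined Phi -> (N Phi)%:R = (chi Phi).[lambda0].

End ChromaticPolynomials.

Arguments has_chromatic_poly {G} Phi.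
Arguments chromatic_poly R {G} Phi.
Arguments zero_free_chromatic_poly R {G} Phi.
Arguments graph_chromatic_poly R Gam.

(* Main.v *)
(* Inclusion-exclusion over the set of satisfied edges writes the number of
   totally frustrated states as the sum over edge sets A of (-1)^|A| times the
   number of states satisfying A.  Such a state is propagated along A from its
   values on one root per component, and the value allowed at a root is any spin
   fixed by the gains of all closed walks of A at that root.  These gains are
   all trivial exactly when the component is balanced, so each of the three
   hypotheses on the action turns the product over the roots into the term of A
   in the corresponding subset expansion at |Q|.  If there are infinitely
   many edges but the group is finite, then finitely many edges already
   represent all constraints.  Conversely, graphs with one vertex and at most
   two loops detect every violation of the hypotheses. *)

Require Import Defs.
From mathcomp Require Import all_boot all_order all_algebra finmap zify.
From mathcomp Require Import boolp classical_sets functions cardinality.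
Local Open Scope classical_set_scope.
Local Open Scope ring_scope.

Set Implicit Arguments.
Unset Strict Implicit.
Unset Printing Implicit Defensive.

Import GRing.Theory Num.Theory.

(** * Walks, their gains and balance *)

(** Locates a repeated vertex ([f] the source) or a repeated edge ([f] the first projection) in a
    closed walk. *)
Lemma not_uniq_map_split (T U : eqType) (f : T -> U) (s : seq T) :
  ~~ uniq (map f s) ->
  exists s1 x s2 y s3, s = s1 ++ x :: s2 ++ y :: s3 /\ f x = f y.
Proof.
elim: s => [|x s IH] //=; rewrite negb_and negbK => /orP[/mapP[y + fxy]|/IH].
  by case/path.splitPr=> s2 s3; exists [::], x, s2, y, s3.
move=> [s1 [x2 [s2 [y2 [s3 [-> fxy]]]]]].
by exists (x :: s1), x2, s2, y2, s3.
Qed.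

Section Walks.
Variables (G : groupType) (Phi : gain_graph G).
Implicit Types (A : {fset edge Phi}) (u v w r : vertex Phi) (o : oedge Phi).
Implicit Types p : seq (oedge Phi).

(** Both endpoints are explicit, so that the empty walk has a base vertex. *)
Fixpoint walk A v p w : bool :=
  if p is o :: p' then [&& source o == v, o.1 \in A & walk A (target o) p' w]
  else v == w.

Definition walk_gain p : G := (\prod_(o <- p) gain o)%g.

Definition reverse_walk p : seq (oedge Phi) := rev [seq reverse o | o <- p].

Lemma source_reverse o : source (reverse o) = target o.
Proof. by case: o => e []. Qed.

Lemma target_reverse o : target (reverse o) = source o.
Proof. by case: o => e []. Qed.

Lemma walk_cat A u p q w :
  reflect (exists2 v, walk A u p v & walk A v q w) (walk A u (p ++ q) w).
Proof.
elim: p u => [|o p IH] u /=.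
  apply: (iffP idP) => [uw|[v /eqP->]] //; by exists u.
apply: (iffP and3P) => [[so oA /IH[v pv vq]]|[v /and3P[so oA pv] vq]].
  by exists v => //; apply/and3P.
by split=> //; apply/IH; exists v.
Qed.

Lemma walk_edges A u p w o : walk A u p w -> o \in p -> o.1 \in A.
Proof.
elim: p u => [|o1 p IH] u //= /and3P[_ oA pw].
by rewrite inE => /orP[/eqP->|/(IH _ pw)].
Qed.

Lemma walk_sub A B u p w :
  walk A u p w -> {in p, forall o, o.1 \in B} -> walk B u p w.
Proof.
elim: p u => [|o p IH] u //= /and3P[-> _ pw] sB; rewrite sB ?mem_head //=.
by apply: IH => // o' o'p; apply: sB; rewrite inE o'p orbT.
Qed.

Lemma walk_reverse A u p w : walk A u p w -> walk A w (reverse_walk p) u.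
Proof.
elim: p u => [|o p IH] u /=; first by rewrite eq_sym.
case/and3P => so oA /IH pw; rewrite /reverse_walk /= rev_cons -cats1.
apply/walk_cat; exists (target o) => //=.
by rewrite source_reverse target_reverse so oA eqxx.
Qed.

Lemma walk_gain_cat p q : walk_gain (p ++ q) = (walk_gain p * walk_gain q)%g.
Proof. exact: big_cat. Qed.

Lemma walk_gain_cons o p : walk_gain (o :: p) = (gain o * walk_gain p)%g.
Proof. exact: big_cons. Qed.

Lemma walk_gain_reverse p : walk_gain (reverse_walk p) = (walk_gain p)^-1%g.
Proof.
rewrite /walk_gain /reverse_walk -map_rev big_map.
under eq_bigr do rewrite gain_reverse.
by rewrite prodgV revK.
Qed.

Lemma connectWP A u w :
  reflect (exists p, walk A u p w) (connect (adjacent A) u w).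
Proof.
apply: (iffP connectP) => [[p]|[p]].
- elim: p u => [|x p IH] u /=; first by move=> _ ->; exists [::] => /=.
  case/andP=> /hasP[e eA /existsP[b /andP[/eqP sb /eqP tb]]] /IH{}IH /IH[q xq].
  by exists ((e, b) :: q); rewrite /= sb tb eqxx eA.
- elim: p u => [|o p IH] u /=; first by move/eqP->; exists [::].
  case/and3P=> /eqP so oA /IH[q qp qw]; exists (target o :: q) => //=.
  rewrite qp andbT; apply/hasP; exists o.1 => //; apply/existsP; exists o.2.
  by rewrite -so -surjective_pairing !eqxx.
Qed.

Lemma adjacent_connect_sym A : connect_sym (adjacent A).
Proof.
by move=> u w; apply/connectWP/connectWP => [] [p /walk_reverse pw];
  exists (reverse_walk p).
Qed.

Lemma mem_component_edges A v e :
  (e \in component_edges A v) = (e \in A) && connect (adjacent A) v (end1 e).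
Proof. by rewrite /component_edges !inE /=. Qed.

Lemma component_edges_walk A r u p w :
  connect (adjacent A) r u -> walk A u p w -> walk (component_edges A r) u p w.
Proof.
elim: p u => [|o p IH] u //= ru /and3P[/eqP so oA pw].
have ro : connect (adjacent A) r (target o).
  apply: connect_trans ru _; apply/connectWP; exists [:: o].
  by rewrite /= so oA !eqxx.
rewrite so eqxx mem_component_edges oA IH //= !andbT.
by case: o so ro {oA pw} => e []; rewrite /source /target //= => ->.
Qed.

(** All closed walks at [r] count here, simple or not. This is the form of balance that propagation
    of spins uses. *)
Definition gain_free A r : Prop := forall p, walk A r p r -> walk_gain p = 1%g.

Lemma simple_walk A p : simple_closed_walk p -> {in p, forall o, o.1 \in A} ->
  if p is o :: _ then walk A (source o) p (source o) else true.
Proof.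
case: p => [|o p] //= /and3P[cp _ _] pA; rewrite eqxx pA ?mem_head //=.
have {pA} : {in p, forall o, o.1 \in A}.
  by move=> x xp; rewrite pA // inE xp orbT.
(* The closing edge is generalized apart from the starting one, so that the induction can advance
   the start alone. *)
move: cp => /=; move: {2 4}o => o'; elim: p o => [|o2 p IH] o1 /=.
  by rewrite andbT => ->.
case/andP=> /eqP -> cp pA; rewrite eqxx pA ?mem_head //= IH //.
by move=> x xp; rewrite pA // inE xp orbT.
Qed.

(* A shortest closed walk of nontrivial gain is simple: cut at a repeated
   vertex, or cancel the two passages of an edge traversed in both
   directions. *)
Lemma balanced_walk A u p : balanced A -> walk A u p u -> walk_gain p = 1%g.
Proof.
move=> bA; have [n] := ubnP (size p).
elim: n u p => // n IH u p /ltnSE; case: p => [|o p] sp pu.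
  by rewrite /walk_gain big_nil.
have cut s1 x s2 y s3 : o :: p = s1 ++ x :: s2 ++ y :: s3 ->
    source x = source y -> walk_gain (o :: p) = 1%g.
  move=> Ep sxy; move: pu sp; rewrite Ep => /walk_cat[v s1v].
  rewrite -cat_cons => /walk_cat[v' xs2 ys3].
  have vx : v = source x by case/and3P: xs2 => /eqP.
  have v'y : v' = source y by case/and3P: ys3 => /eqP.
  rewrite !size_cat /= => sz; subst v v'.
  have e2 : walk_gain (x :: s2) = 1%g.
    apply: (IH (source x)); last by rewrite {2}sxy.
    by rewrite ?size_cat /=; lia.
  have e1 : walk_gain (s1 ++ y :: s3) = 1%g.
    apply: (IH u); last by apply/walk_cat; exists (source x); rewrite // sxy.
    by rewrite ?size_cat /=; lia.
  by rewrite walk_gain_cat -cat_cons walk_gain_cat e2 mul1g -walk_gain_cat.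
have [us|/not_uniq_map_split[s1 [x [s2 [y [s3 [/cut]]]]]]] :=
  boolP (uniq (map (@source Phi) (o :: p))); last exact.
have [ue|/not_uniq_map_split[s1 [x [s2 [y [s3 [Ep exy]]]]]]] :=
  boolP (uniq (map (fun o : oedge Phi => o.1) (o :: p))).
  apply: bA => [|x xp]; last exact: walk_edges pu xp.
  apply/and3P; split=> //=; move/and3P: pu => [/eqP so _ {us ue sp cut}].
  rewrite -{}so; move: {2 4}o => o'; elim: p o => [|o2 p IHp] o1 /=.
    by rewrite andbT.
  by case/and3P=> /eqP-> _ /IHp->; rewrite eqxx.
(* Two passages in the same direction have the same source, which [cut] handles; only opposite
   directions remain. *)
have [xy|nxy] := eqVneq x.2 y.2.
  apply: cut Ep _.
  by rewrite (surjective_pairing x) (surjective_pairing y) exy xy.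
have {nxy exy} Ey : y = reverse x.
  rewrite (surjective_pairing y) /reverse exy; congr pair.
  by case: x.2 y.2 nxy => [] [].
subst y; move: pu sp; rewrite Ep => /walk_cat[v s1v] /= /and3P[/eqP vx xA].
move=> /walk_cat[v' s2v'] /= /and3P[/eqP v'x _ s3u].
rewrite source_reverse in v'x; rewrite target_reverse in s3u; subst v v'.
rewrite !size_cat /= !size_cat /= => sz.
have e2 : walk_gain s2 = 1%g.
  by apply: IH s2v'; rewrite ?size_cat /=; lia.
have e1 : walk_gain (s1 ++ s3) = 1%g.
  apply: (IH u); last by apply/walk_cat; exists (source x).
  by rewrite ?size_cat /=; lia.
rewrite walk_gain_cat walk_gain_cons walk_gain_cat e2 mul1g walk_gain_cons.
by rewrite gain_reverse mulVKg -walk_gain_cat.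
Qed.

(** Conjugating a closed walk at [u] by a walk from [r] to [u] gives a closed walk at [r], and a
    gain with a trivial conjugate is trivial. *)
Lemma gain_free_connect A r u :
  connect (adjacent A) r u -> gain_free A r -> gain_free A u.
Proof.
move=> /connectWP[q qu] free_r p pu.
have := free_r (q ++ p ++ reverse_walk q).
rewrite !walk_gain_cat walk_gain_reverse.
move=> /(_ _)/(congr1 (fun g => g ^ walk_gain q)%g).
rewrite conj1g conjgE !mulgA mulVg mul1g mulgVK; apply.
apply/walk_cat; exists u => //; apply/walk_cat; exists u => //.
exact: walk_reverse.
Qed.

(** A walk starting at [r] stays in its component. Conversely, a simple closed walk in the component
    is based at a vertex connected to [r], so [gain_free_connect] applies. *)
Lemma balanced_componentP A r :
  balanced (component_edges A r) <-> gain_free A r.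
Proof.
split=> [bA p pr | free_r [|o c] sc cA].
- by apply: balanced_walk bA _; apply: component_edges_walk pr; apply: connect0.
- by rewrite big_nil.
have w := simple_walk sc cA.
apply: gain_free_connect free_r _ _; last first.
  by apply: walk_sub w _ => x /cA; rewrite mem_component_edges => /andP[].
have := cA o (mem_head _ _); rewrite mem_component_edges => /andP[oA ro].
case: o oA ro {cA w sc} => e [] //= eA re; apply: connect_trans re _.
apply/connectWP; exists [:: (e, true)].
by rewrite /= eA !eqxx.
Qed.

(** Each vertex is connected to the root of its component, so closed walks need testing at the roots
    only. *)
Lemma balancedP A :
  balanced A <-> forall r, fingraph.roots (adjacent A) r -> gain_free A r.
Proof.
split=> [bA r _ p|free [|o c] sc cA]; first exact: balanced_walk.
  by rewrite big_nil.
have symA := @adjacent_connect_sym A.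
have := fingraph.connect_root (adjacent A) (source o); rewrite symA.
move/gain_free_connect => /(_ (free _ (fingraph.roots_root symA _))); apply.
exact: simple_walk sc cA.
Qed.

End Walks.

(** * Satisfied edges and propagation of spins along walks *)

Section Satisfaction.
Variables (G : groupType) (Q : choiceType) (act : Q -> G -> Q).
Hypothesis act_right : is_right_action act.
Variable Phi : gain_graph G.
Implicit Types (s : {ffun vertex Phi -> Q}) (A : {fset edge Phi}).

(** Testing the reference orientation is enough: for a right action the reverse orientation gives
    the same condition, see [satisfiedE]. *)
Definition edge_satisfied s (e : edge Phi) : bool :=
  `[< satisfied act s (e, true) >].

(** The constraint that satisfying all of [A] puts on the spin at [r]. *)
Definition walk_fixed A (r : vertex Phi) (q : Q) : bool :=
  `[< forall p, walk A r p r -> act q (walk_gain p) = q >].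

Lemma walk_fixedP A r q :
  reflect (forall p, walk A r p r -> act q (walk_gain p) = q)
    (walk_fixed A r q).
Proof. exact: asboolP. Qed.

Lemma actK g : cancel (act^~ g) (act^~ (g^-1)%g).
Proof. by case: act_right => a1 aM q; rewrite /= -aM mulgV a1. Qed.

Lemma actVK g : cancel (act^~ (g^-1)%g) (act^~ g).
Proof. by case: act_right => a1 aM q; rewrite /= -aM mulVg a1. Qed.

Lemma satisfied_reverse s o : satisfied act s o -> satisfied act s (reverse o).
Proof.
rewrite /satisfied source_reverse target_reverse gain_reverse => ->.
by rewrite actK.
Qed.

Lemma satisfiedE s (o : oedge Phi) : satisfied act s o <-> edge_satisfied s o.1.
Proof.
rewrite /edge_satisfied asboolE; case: o => e [] //=.
by split=> /satisfied_reverse.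
Qed.

Lemma totally_frustratedE s :
  totally_frustrated act s <-> forall e, ~~ edge_satisfied s e.
Proof.
split=> [fs e|fs o /satisfiedE]; last by rewrite (negPf (fs _)).
by apply/negP => /(satisfiedE s (e, true)); apply: fs.
Qed.

Lemma satisfied_walk s A u p w : all (edge_satisfied s) A ->
  walk A u p w -> s w = act (s u) (walk_gain p).
Proof.
move=> /allP sA; have [a1 aM] := act_right.
elim: p u => [|o p IH] u /=; first by move/eqP->; rewrite /walk_gain big_nil a1.
by case/and3P=> /eqP <- /sA /satisfiedE so /IH ->; rewrite walk_gain_cons aM so.
Qed.

End Satisfaction.

(** * Counting the states that satisfy a given edge set *)

Section StateCount.
Variables (G : groupType) (Q : finType) (act : Q -> G -> Q).
Hypothesis act_right : is_right_action act.
Variable Phi : gain_graph G.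
Implicit Types (s : {ffun vertex Phi -> Q}) (A : {fset edge Phi}).

(** A satisfying state is determined by its values at the component roots, since [satisfied_walk]
    propagates them. The root values that occur are exactly the families of spins fixed by all
    closed walks at the roots. *)
Lemma card_satisfied A :
  #|[pred s : {ffun vertex Phi -> Q} | all (edge_satisfied act s) A]| =
  (\prod_(r | fingraph.roots (adjacent A) r)
     #|[pred q : Q | walk_fixed act A r q]|)%N.
Proof.
have [a1 aM] := act_right; have symA := @adjacent_connect_sym _ Phi A.
pose T := {r in fingraph.roots (adjacent A)}.
pose rt v : T :=
  Sub (fingraph.root (adjacent A) v) (fingraph.roots_root symA v).
have /choice[path_from_root pathP] v :
    exists p, walk A (fingraph.root (adjacent A) v) p v.
  by apply/connectWP; rewrite symA fingraph.connect_root.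
pose restrict s : {ffun T -> Q} := [ffun t : T => s (val t)].
pose fixed (t : T) := [pred q : Q | walk_fixed act A (val t) q].
rewrite -(@card_in_image _ _ restrict); last first.
  move=> s1 s2; rewrite !inE => sat1 sat2 /ffunP eq12; apply/ffunP => v.
  have := eq12 (rt v); rewrite !ffunE /= => Er.
  by rewrite (satisfied_walk act_right sat1 (pathP v)) Er
    -(satisfied_walk act_right sat2 (pathP v)).
transitivity #|family fixed|; last first.
  rewrite card_family foldrE /image_mem big_map big_enum /=.
  by rewrite -(big_sub _ (fun r => #|[pred q | walk_fixed act A r q]|)).
apply: eq_card => f; apply/fintype.imageP/familyP => [[s] | fixed_f].
  rewrite inE => sat_s -> t; rewrite ffunE inE => p tp.
  by rewrite -(satisfied_walk act_right sat_s tp).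
(* The preimage of [f]: each root value is carried to [v] along the chosen walk. *)
pose s := [ffun v => act (f (rt v)) (walk_gain (path_from_root v))].
have fixedP (t : T) p :
    walk A (val t) p (val t) -> act (f t) (walk_gain p) = f t.
  by have := fixed_f t; rewrite inE; apply.
exists s.
  rewrite inE; apply/allP => e eA; apply/asboolP.
  rewrite /satisfied !ffunE -aM.
  set v := source (e, true); set w := target (e, true).
  have vw : walk A v [:: (e, true)] w by rewrite /= eA !eqxx.
  have Erw : rt w = rt v.
    apply: val_inj; apply/(fingraph.rootP symA); rewrite symA.
    by apply/connectWP; exists [:: (e, true)].
  (* Out to [v], across [e] and back from [w]: that this closed walk fixes the root value says that
     [e] is satisfied. *)
  have closed_walk : walk A (val (rt v))
      (path_from_root v ++ [:: (e, true)] ++ reverse_walk (path_from_root w))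
      (val (rt v)).
    apply/walk_cat; exists v; first exact: pathP.
    apply/walk_cat; exists w => //; apply: walk_reverse.
    by have := pathP w; rewrite -[fingraph.root _ w]/(val (rt w)) Erw.
  rewrite Erw -{1}(fixedP _ _ closed_walk) !walk_gain_cat walk_gain_reverse.
  rewrite walk_gain_cons {2}/walk_gain big_nil mulg1 mulgA.
  by rewrite [in LHS]aM (actVK act_right).
(* The walk chosen for a root need not be empty, but it is closed and so fixes the root value. *)
apply/ffunP => t; rewrite !ffunE.
have Et : rt (val t) = t by apply: val_inj; apply/eqP; exact: (valP t).
rewrite Et fixedP //.
by have := pathP (val t); rewrite -[fingraph.root _ _]/(val (rt (val t))) Et.
Qed.

End StateCount.

(** * Finite counts, representatives and signed sums over subsets *)

Lemma ncard_pred (T : finType) (A : set T) (P : pred T) :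
  (forall x, A x <-> P x) -> ncard A = #|P|.
Proof.
move=> AP; rewrite /ncard cardE; apply: perm_size.
apply: uniq_perm; rewrite ?enum_uniq ?fset_uniq // => x.
rewrite mem_enum in_fset_set; last exact: finite_finset.
by apply/idP/idP; rewrite inE => /AP.
Qed.

(** One preimage is chosen for each value. This reduces infinitely many edges of finitely many kinds
    to a finite edge set. *)
Lemma finite_representatives (E T : choiceType) (f : E -> T) :
  finite_set (range f) ->
  exists F : {fset E}, forall e, exists2 e', e' \in F & f e' = f e.
Proof.
case/finite_fsetP=> Y rangeY.
have /choice[g gK] (y : Y) : exists e, f e = val y.
  have : range f (val y) by rewrite rangeY; exact: valP.
  by case=> e _ fe; exists e.
exists [fset g y | y : Y]%fset => e.
have eY : f e \in Y.
  by have : range f (f e) by []; rewrite rangeY.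
by exists (g [` eY]%fset); rewrite ?gK //; apply/imfsetP; exists [` eY]%fset.
Qed.

(** The sum is the expansion of the product over [F] of 1 minus the indicator of [P], which vanishes
    as soon as one element satisfies [P]. *)
Lemma sum_sign_fpowerset (R : comNzRingType) (K : choiceType) (F : {fset K})
    (P : pred K) :
  \sum_(A <- fpowerset F | all P A) (-1) ^+ #|` A| = (~~ has P F)%:R :> R.
Proof.
(* The subsets of [F] are reindexed by the finite sets over the subtype of its elements, where
   [bigA_distr] applies. *)
rewrite big_mkcond big_imfset /=; last first.
  move=> X Y _ _ /fsetP eqXY; apply/setP => x.
  by have := eqXY (val x); rewrite !inE.
transitivity (\prod_(x : F) (- (P (val x))%:R + 1) : R).
  rewrite bigA_distr big_enum /=; apply: eq_big => [X|X _].
    by rewrite powersetE finset.subsetT.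
  rewrite -big_mkcond /=.
  have memX x : (val x \in [fsetval y in X]%fset) = (x \in X) by rewrite !inE.
  have [PX|/allPn[y]] := boolP (all P [fsetval y in X]%fset).
    under eq_bigr => x xX do rewrite (allP PX) ?memX //.
    by rewrite prodr_const card_imfset -?cardE //; exact: val_inj.
  case/imfsetP=> x /= xX -> /negPf Px.
  by rewrite (bigD1 x) //= Px oppr0 mul0r.
have [/hasP[x xF Px]|nP] := boolP (has P F).
  by rewrite (bigD1 [` xF]%fset) //= Px addNr mul0r.
apply: big1 => x _; have := hasPn nP _ (valP x) => /negPf ->.
by rewrite oppr0 add0r.
Qed.

(** * Subset expansions over a finite edge set *)

Section SubsetSums.
Variables (R : numDomainType) (G : groupType) (Phi : gain_graph G).
Implicit Types F A : {fset edge Phi}.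

(** The set [F] is arbitrary, so that it can stand for an infinite edge set by representatives. *)
Definition chromatic_sum F : {poly R} :=
  \sum_(A <- fpowerset F) (-1) ^+ #|` A| *: 'X^(nb_balanced_components A).

Definition zero_free_sum F : {poly R} :=
  \sum_(A <- fpowerset F | `[< balanced A >])
    (-1) ^+ #|` A| *: 'X^(nb_balanced_components A).

End SubsetSums.

(** * Inclusion-exclusion, and its form under each hypothesis on the action *)

Section Expansion.
Variables (R : numDomainType) (G : groupType) (Q : finType) (act : Q -> G -> Q).
Hypothesis act_right : is_right_action act.
Variables (Phi : gain_graph G) (F : {fset edge Phi}).
Hypothesis F_rep : forall s e, edge_satisfied act s e ->
  exists2 e', e' \in F & edge_satisfied act s e'.

(** By [F_rep], frustration of the edges of [F] is total frustration. [sum_sign_fpowerset] writes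
    its indicator as a signed sum over sets of satisfied edges; exchanging the sums leaves the
    counts of [card_satisfied]. *)
Lemma nb_frustrated_expansion :
  (nb_frustrated act Phi)%:R =
  \sum_(A <- fpowerset F) (-1) ^+ #|` A| *
    (\prod_(r | fingraph.roots (adjacent A) r)
       #|[pred q : Q | walk_fixed act A r q]|)%:R :> R.
Proof.
rewrite /nb_frustrated (@ncard_pred _ _
  [pred s | ~~ has (edge_satisfied act s) F]); last first.
  move=> s; rewrite (totally_frustratedE act_right); split=> [fs|nF e].
    by apply/hasPn => e _; exact: fs.
  by apply/negP => /F_rep[e' e'F se']; move/hasP: nF; apply; exists e'.
transitivity (\sum_(s : {ffun vertex Phi -> Q})
    \sum_(A <- fpowerset F | all (edge_satisfied act s) A) (-1) ^+ #|` A| : R).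
  rewrite -sum1_card natr_sum big_mkcond; apply: eq_bigr => s _.
  by rewrite sum_sign_fpowerset inE; case: has.
under eq_bigr do rewrite big_mkcond.
rewrite exchange_big; apply: eq_bigr => A _.
rewrite -(card_satisfied act_right) -big_mkcond /= sumr_const mulr_natr.
by congr (_ *+ _); apply: eq_card => s; rewrite !inE.
Qed.

Lemma card_walk_fixed_free (A : {fset edge Phi}) r : gain_free A r ->
  #|[pred q : Q | walk_fixed act A r q]| = #|Q|.
Proof.
move=> free; apply: eq_card => q; rewrite inE; apply/walk_fixedP => p /free ->.
by case: act_right.
Qed.

Lemma nb_balanced_componentsE (A : {fset edge Phi}) :
  nb_balanced_components A =
  #|[pred r | fingraph.roots (adjacent A) r & `[< gain_free A r >]]|.
Proof.
apply: eq_card => r; rewrite !inE; congr andb.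
by apply/asboolP/asboolP => /balanced_componentP.
Qed.

(** At the root of an unbalanced component some closed walk has nontrivial gain, so [q0] is the only
    spin allowed. A balanced component allows all spins, hence the exponent counts balanced
    components. *)
Lemma nb_frustrated_chromatic_sum (q0 : Q) :
  (forall g, g <> 1%g -> Fix act g = [set q0]) ->
  (nb_frustrated act Phi)%:R = (chromatic_sum R F).[#|Q|%:R].
Proof.
move=> fix_q0; rewrite nb_frustrated_expansion horner_sum.
apply: eq_bigr => A _; rewrite hornerZ hornerXn; congr (_ * _).
rewrite nb_balanced_componentsE -natrX -prod_nat_const big_mkcondr /=.
congr (_%:R); apply: eq_bigr => r _.
case: asboolP => [/card_walk_fixed_free //|].
move=> /existsNP[p /not_implyP[pr gp]].
apply: (fintype.eq_card1 (x := q0)) => q.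
rewrite !inE; apply/walk_fixedP/eqP => [/(_ p pr)|->].
  by move: (fix_q0 _ gp) => /seteqP[+ _]; apply.
move=> p' _; have [->|/eqP/fix_q0 Eq0] := eqVneq (walk_gain p') 1%g.
  by case: act_right.
by have : [set q0] q0 by []; rewrite -Eq0.
Qed.

(** For unbalanced [A] some root has a closed walk of nontrivial gain, which fixes no spin, so the
    term vanishes. For balanced [A] every root allows all spins. *)
Lemma nb_frustrated_zero_free_sum :
  (forall g, Fix act g !=set0 -> g = 1%g) ->
  (nb_frustrated act Phi)%:R = (zero_free_sum R F).[#|Q|%:R].
Proof.
move=> act_free; rewrite nb_frustrated_expansion horner_sum [RHS]big_mkcond /=.
apply: eq_bigr => A _; case: asboolP => [/balancedP free|].
  rewrite hornerZ hornerXn; congr (_ * _).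
  rewrite nb_balanced_componentsE -natrX -prod_nat_const big_mkcondr /=.
  congr (_%:R); apply: eq_bigr => r rr.
  rewrite card_walk_fixed_free; last exact: free.
  by case: asboolP => // /(_ (free r rr)).
move=> /balancedP/existsNP[r /not_implyP[rr /existsNP[p /not_implyP[pr gp]]]].
rewrite (bigD1 r) //= fintype.eq_card0 ?mul0n ?mulr0 // => q; rewrite !inE.
apply/negP => /walk_fixedP/(_ p pr) fix_p.
by apply/gp/act_free; exists q.
Qed.

Lemma nb_frustrated_trivial :
  (forall q g, act q g = q) ->
  (nb_frustrated act Phi)%:R =
  (\sum_(A <- fpowerset F)
     (-1) ^+ #|` A| *: 'X^(fingraph.n_comp (adjacent A) predT)).[#|Q|%:R] :> R.
Proof.
move=> act_trivial; rewrite nb_frustrated_expansion horner_sum.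
apply: eq_bigr => A _; rewrite hornerZ hornerXn; congr (_ * _).
rewrite /n_comp_mem -natrX -prod_nat_const; congr (_%:R).
apply: eq_big => r; first by rewrite !inE andbT.
move=> _; apply: eq_card => q; rewrite inE; apply/walk_fixedP => p _.
exact: act_trivial.
Qed.

End Expansion.

(** * Interpolation and change of spin set *)

(** Distinct naturals stay distinct in [R], so a nonzero difference would have as many roots as its
    size, one more than its degree. *)
Lemma poly_eq_on_nat (R : numDomainType) (h : nat -> nat) (p q : {poly R}) :
  injective h -> (forall k, p.[(h k)%:R] = q.[(h k)%:R]) -> p = q.
Proof.
move=> h_inj pq; apply/eqP; rewrite -subr_eq0; apply/negPn/negP => d0.
pose rs : seq R := [seq (h k)%:R | k <- iota 0 (size (p - q))].
have : (size rs < size (p - q)%R)%N.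
  apply: max_poly_roots d0 _ _.
    by apply/allP => _ /mapP[k _ ->]; rewrite rootE !hornerE pq subrr.
  rewrite map_inj_uniq ?iota_uniq // => k l /eqP.
  by rewrite eqr_nat => /eqP/h_inj.
by rewrite size_map size_iota ltnn.
Qed.

(** Moves a count to a [finType] of spins, where the expansion applies; the spins [G * 'I_k] form
    only a choice type. *)
Lemma nb_frustrated_bij (G : groupType) (Q : choiceType) (Q' : finType)
    (act : Q -> G -> Q) (act' : Q' -> G -> Q') (f : Q' -> Q)
    (Phi : gain_graph G) :
  bijective f -> (forall q g, f (act' q g) = act (f q) g) ->
  nb_frustrated act Phi = nb_frustrated act' Phi.
Proof.
move=> f_bij f_act; have f_inj := bij_inj f_bij; case: f_bij => f' fK f'K.
pose fs (s : {ffun vertex Phi -> Q'}) : {ffun vertex Phi -> Q} :=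
  [ffun v => f (s v)].
rewrite /nb_frustrated.
have -> : totally_frustrated act (Phi := Phi) =
    fs @` totally_frustrated act' (Phi := Phi).
  apply/seteqP; split=> [s frus|_ [s frus <-] o] /=; last first.
    by rewrite /satisfied !ffunE -f_act => /f_inj; exact: frus.
  exists [ffun v => f' (s v)]; last by apply/ffunP => v; rewrite !ffunE f'K.
  move=> o; rewrite /satisfied !ffunE => /(congr1 f).
  by rewrite f_act !f'K; exact: frus.
rewrite /ncard fset_set_image; last exact: finite_finset.
rewrite card_imfset //= => s1 s2 /ffunP eqs; apply/ffunP => v.
by apply: f_inj; have := eqs v; rewrite !ffunE.
Qed.

(** * Chromatic polynomials as finite subset sums *)

Section Representatives.
Variables (R : numDomainType) (G : groupType) (Phi : gain_graph G).
Implicit Types F : {fset edge Phi}.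

(** All that the satisfaction of an edge depends on. *)
Definition edge_data (e : edge Phi) := (end1 e, end2 e, gain (e, true)).

Definition representatives F : Prop :=
  forall e, exists2 e', e' \in F & edge_data e' = edge_data e.

Lemma representatives_satisfied (Q : finType) (act : Q -> G -> Q) F s e :
  representatives F -> edge_satisfied act s e ->
  exists2 e', e' \in F & edge_satisfied act s e'.
Proof.
move=> /(_ e)[e' e'F [E1 E2 Eg]] se; exists e' => //; move: se.
by rewrite /edge_satisfied /satisfied /source /target /= E1 E2 Eg.
Qed.

(** A finite edge set is kept whole, so that the sum over it is the defining expansion. Otherwise
    the group is finite and only finitely many values of [edge_data] occur. *)
Lemma exists_representatives : has_chromatic_poly Phi ->
  exists2 F, representatives F & finite_set [set: edge Phi] ->
    F = fset_set [set: edge Phi].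
Proof.
move=> has_poly; have [finE|infE] := pselect (finite_set [set: edge Phi]).
  exists (fset_set [set: edge Phi]) => // e; exists e => //.
  by rewrite in_fset_set // inE.
case: has_poly => // finG.
have [|F Frep] := @finite_representatives _ _ edge_data; last first.
  by exists F => // /infE.
apply: (@sub_finite_set _ _ ([set: vertex Phi * vertex Phi] `*` [set: G])).
  by move=> x _; split.
by apply: finite_setX => //; exact: finite_finset.
Qed.

Section FiniteGroup.
Variables (F : {fset edge Phi}) (k : nat).
Hypotheses (Frep : representatives F) (finG : finite_set [set: G]).

(** A copy of the finite group as a [finType]. *)
Let S := fset_set [set: G].
Let in_S (g : G) : g \in S. Proof. by rewrite in_fset_set // inE. Qed.
Let toS (g : G) : S := [` in_S g]%fset.

Let act_free (q : S * 'I_k) (g : G) : S * 'I_k := (toS (val q.1 * g)%g, q.2).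
Let act0 (q : option (S * 'I_k)) (g : G) := omap (act_free^~ g) q.

Let val_free (q : S * 'I_k) : G * 'I_k := (val q.1, q.2).

Let free_val (q : G * 'I_k) : S * 'I_k := (toS q.1, q.2).

Let val_freeK : cancel val_free free_val.
Proof. by case=> g i; congr pair; apply: val_inj. Qed.

Let free_valK : cancel free_val val_free.
Proof. by case. Qed.

Let act_free_right : is_right_action act_free.
Proof.
split=> [[g i]|[g i] h h']; congr pair; apply: val_inj.
  by rewrite /= mulg1.
by rewrite /= mulgA.
Qed.

Let act0_right : is_right_action act0.
Proof.
case: act_free_right => a1 aM.
by split=> [[q|]|[q|] g h] //=; rewrite ?a1 ?aM.
Qed.

Let act_freeP q g : act_free q g = q -> g = 1%g.
Proof.
case: q => h i [] /(congr1 val)/= /(congr1 (fun x => (val h)^-1 * x)%g).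
by rewrite mulKg mulVg.
Qed.

Lemma nb_frustrated_act_zero_free :
  (nb_frustrated (@act_zero_free G k) Phi)%:R =
  (zero_free_sum R F).[(k * ncard [set: G])%:R].
Proof.
rewrite (@nb_frustrated_bij _ _ _ _ act_free val_free) //; last first.
  exact: Bijective val_freeK free_valK.
rewrite (@nb_frustrated_zero_free_sum _ _ _ _ act_free_right _ F).
- by rewrite card_prod card_ord mulnC -cardfE.
- by move=> s e; exact: representatives_satisfied.
- by move=> g [q]; exact: act_freeP.
Qed.

(** The spin [None] plays the part of [q0] and accounts for the summand 1. *)
Lemma nb_frustrated_act_zero :
  (nb_frustrated (@act_zero G k) Phi)%:R =
  (chromatic_sum R F).[(k * ncard [set: G] + 1)%:R].
Proof.
rewrite (@nb_frustrated_bij _ _ _ _ act0 (omap val_free)) //; last 2 first.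
- exact: Bijective (omapK val_freeK) (omapK free_valK).
- by case.
rewrite (@nb_frustrated_chromatic_sum _ _ _ _ act0_right _ F _ None).
- by rewrite card_option card_prod card_ord mulnC -cardfE addn1.
- by move=> s e; exact: representatives_satisfied.
- move=> g g1; apply/seteqP; split=> [[q|] //|_ ->] // [].
  by move=> /act_freeP.
Qed.

End FiniteGroup.

Lemma ncard_group_gt0 : finite_set [set: G] -> (0 < ncard [set: G])%N.
Proof.
move=> finG; rewrite /ncard cardfs_gt0; apply/fset0Pn; exists 1%g.
by rewrite in_fset_set // inE.
Qed.

(** The sum meets the specification, so the polynomial picked by [xget] meets it too. The two agree
    by interpolation if the group is finite, and by the explicit expansion if the edge set is
    finite. *)
Lemma chromatic_polyE F : representatives F ->
  (finite_set [set: edge Phi] -> F = fset_set [set: edge Phi]) ->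
  has_chromatic_poly Phi -> chromatic_poly R Phi = chromatic_sum R F.
Proof.
move=> Frep FE has_poly.
have sumP : is_chromatic_poly Phi (chromatic_sum R F).
  split=> [finG k|/FE->] //.
  by rewrite (nb_frustrated_act_zero k Frep finG).
have [polyG polyE] : is_chromatic_poly Phi (chromatic_poly R Phi).
  by apply: xgetPex; exists (chromatic_sum R F).
case: has_poly => [finG|finE]; last by rewrite polyE //; case: sumP => _ ->.
apply: (@poly_eq_on_nat _ (fun k => k * ncard [set: G] + 1)%N) => [k l|k].
  by move=> /addIn/eqP; rewrite eqn_pmul2r ?ncard_group_gt0 // => /eqP.
by rewrite polyG // (nb_frustrated_act_zero k Frep finG).
Qed.

Lemma zero_free_chromatic_polyE F : representatives F ->
  (finite_set [set: edge Phi] -> F = fset_set [set: edge Phi]) ->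
  has_chromatic_poly Phi -> zero_free_chromatic_poly R Phi = zero_free_sum R F.
Proof.
move=> Frep FE has_poly.
have sumP : is_zero_free_chromatic_poly Phi (zero_free_sum R F).
  split=> [finG k|/FE->] //.
  by rewrite (nb_frustrated_act_zero_free k Frep finG).
have [polyG polyE] :
    is_zero_free_chromatic_poly Phi (zero_free_chromatic_poly R Phi).
  by apply: xgetPex; exists (zero_free_sum R F).
case: has_poly => [finG|finE]; last by rewrite polyE //; case: sumP => _ ->.
apply: (@poly_eq_on_nat _ (fun k => k * ncard [set: G])%N) => [k l|k].
  by move=> /eqP; rewrite eqn_pmul2r ?ncard_group_gt0 // => /eqP.
by rewrite polyG // (nb_frustrated_act_zero_free k Frep finG).
Qed.

End Representatives.

(** * Trivial actions and proper colorings *)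

Section TrivialAction.
Variables (R : numDomainType) (G : groupType) (Phi : gain_graph G).

Let trivial_act (k : nat) (q : 'I_k) (g : G) := q.

Lemma nb_frustrated_proper_coloring k :
  nb_frustrated (@trivial_act k) Phi =
  ncard (proper_coloring (Gam := Phi) (k := k)).
Proof.
congr ncard; apply/seteqP; split=> s frus => [e E|[e []] E].
- apply: (frus (e, true)).
  by rewrite /satisfied /trivial_act /source /target /= E.
- by apply: (frus e).
- by apply: (frus e).
Qed.

(** A polynomial counting colorings exists: parallel edges impose the same condition, so one edge
    for each occurring pair of endpoints suffices, and the expansion for the trivial action gives
    the polynomial. *)
Lemma graph_chromatic_polyP k :
  (graph_chromatic_poly R Phi).[k%:R] =
  (ncard (proper_coloring (Gam := Phi) (k := k)))%:R.
Proof.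
suff /(@xgetPex _ 0) : exists p : {poly R}, forall k,
    p.[k%:R] = (ncard (proper_coloring (Gam := Phi) (k := k)))%:R by apply.
have [|F Frep] := @finite_representatives _ _ (fun e => (@end1 Phi e, end2 e)).
  exact: (@finite_finset (vertex Phi * vertex Phi)%type).
exists (\sum_(A <- fpowerset F)
  (-1) ^+ #|` A| *: 'X^(fingraph.n_comp (adjacent A) predT)) => n.
rewrite -nb_frustrated_proper_coloring.
rewrite (@nb_frustrated_trivial R _ _ _ _ _ F) //.
  by rewrite card_ord.
move=> s e; rewrite /edge_satisfied /satisfied /source /target /= => se.
by have [e' e'F [E1 E2]] := Frep e; exists e'; rewrite // E1 E2.
Qed.

Lemma nb_frustrated_trivial_act (Q : finType) (act : Q -> G -> Q) :
  (forall q g, act q g = q) ->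
  nb_frustrated act Phi = ncard (proper_coloring (Gam := Phi) (k := #|Q|)).
Proof.
move=> act_trivial; rewrite -nb_frustrated_proper_coloring.
apply: (@nb_frustrated_bij _ _ _ _ _ enum_val) => [|q g].
  exact: enum_val_bij.
by rewrite act_trivial.
Qed.

End TrivialAction.

(** * One-vertex graphs, with loops of prescribed gains *)

Section Bouquet.
Variables (G : groupType) (I : finType) (g : I -> G).

Definition bouquet_graph : multigraph :=
  @Multigraph unit I (fun=> tt) (fun=> tt).

Definition bouquet_gain (o : oedge bouquet_graph) : G :=
  if o.2 then g o.1 else (g o.1)^-1%g.

Lemma bouquet_gain_reverse o :
  bouquet_gain (reverse o) = (bouquet_gain o)^-1%g.
Proof. by case: o => i []; rewrite /bouquet_gain //= invgK. Qed.

Definition bouquet : gain_graph G := GainGraph bouquet_gain_reverse.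

Lemma nb_frustrated_bouquet (Q : finType) (act : Q -> G -> Q) :
  is_right_action act ->
  nb_frustrated act bouquet = #|[pred q | [forall i, act q (g i) != q]]|.
Proof.
move=> act_right; rewrite /nb_frustrated.
pose at_vertex (s : {ffun vertex bouquet -> Q}) := s tt.
rewrite (@ncard_pred _ _
  [preim at_vertex of [pred q | [forall i, act q (g i) != q]]]); last first.
  move=> s; rewrite (totally_frustratedE act_right).
  split=> [frus|/forallP frus i].
    by apply/forallP => i; apply: contra (frus i) => /eqP E; apply/asboolP.
  by apply: contra (frus i) => /asboolP E; apply/eqP.
rewrite card_preim => [|s1 s2 Es]; last by apply/ffunP => -[].
apply: eq_card => q; rewrite !inE andb_idl // => _.
by apply/codomP; exists [ffun=> q]; rewrite /at_vertex ffunE.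
Qed.

Lemma bouquet_has_chromatic_poly : has_chromatic_poly bouquet.
Proof. by right; exact: (@finite_finset I). Qed.

Let E : {fset edge bouquet} := fset_set [set: I].

Let in_E i : i \in E.
Proof. by rewrite in_fset_set ?inE //; exact: finite_finset. Qed.

Let E_rep : representatives E.
Proof. by move=> e; exists e; rewrite ?in_E. Qed.

Hypothesis g1 : forall i, g i <> 1%g.

(** A single loop is already a simple closed walk, and its gain is nontrivial. *)
Lemma bouquet_balanced (A : {fset edge bouquet}) : balanced A <-> A = fset0.
Proof.
split=> [bA|-> [|o w] _ oA]; last 2 first.
- by rewrite big_nil.
- by have := oA o (mem_head _ _); rewrite inE.
apply/fsetP => i; rewrite inE; apply/negbTE/negP => iA; apply: (@g1 i).
have := bA [:: (i, true)]; rewrite big_cons big_nil mulg1; apply=> //.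
by move=> o; rewrite inE => /eqP->.
Qed.

Lemma bouquet_nb_balanced_components (A : {fset edge bouquet}) :
  nb_balanced_components A = (A == fset0).
Proof.
have EA : component_edges A (tt : vertex bouquet) = A.
  by apply/fsetP => e; rewrite mem_component_edges connect0 andbT.
rewrite nb_balanced_componentsE.
have free_tt r : `[< gain_free A r >] = (A == fset0).
  apply/asboolP/eqP => [|A0].
    by case: r => /balanced_componentP; rewrite EA => /bouquet_balanced.
  by case: r; apply/balanced_componentP; rewrite EA; apply/bouquet_balanced.
case: (A == fset0) free_tt => free_tt /=.
  by apply: (fintype.eq_card1 (x := tt)) => -[]; rewrite unfold_in /= free_tt.
by apply: eq_card0 => r; rewrite unfold_in /= free_tt.
Qed.

Let filter_fpowerset0 :
  [seq A <- fpowerset E | A == fset0] = [:: fset0].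
Proof.
by apply: filter_pred1_uniq; rewrite ?fset_uniq ?fpowersetE ?fsub0set.
Qed.

Lemma bouquet_chromatic_poly (R : numDomainType) :
  chromatic_poly R bouquet = 'X - (0 < #|I|)%N%:R.
Proof.
rewrite (chromatic_polyE R E_rep _ bouquet_has_chromatic_poly) //.
(* A nonempty set contributes its sign, the empty set contributes ['X]. With ['X - 1] split off at
   the empty set, the signs add up to 0 if there is a loop and to 1 if there is none. *)
transitivity (\sum_(A <- fpowerset E)
    ((-1) ^+ #|` A| + (if A == fset0 then 'X - 1 else 0)) : {poly R}).
  apply: eq_bigr => A _; rewrite bouquet_nb_balanced_components.
  case: eqP => [->|_].
    by rewrite cardfs0 expr0 scale1r expr1 addrC subrK.
  by rewrite addr0 expr0 alg_polyC rmorphXn /= rmorphN1.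
rewrite big_split /= -big_mkcond -[X in _ + X]big_filter.
rewrite filter_fpowerset0 big_seq1.
have -> : \sum_(A <- fpowerset E) (-1) ^+ #|` A| =
    (~~ has predT E)%:R :> {poly R}.
  by rewrite -sum_sign_fpowerset; apply: eq_bigl => A; rewrite all_predT.
have -> : #|I| = size E by rewrite -(@ncard_pred _ [set: I] predT).
by rewrite has_predT; case: (0 < _)%N; rewrite ?add0r // subr0 addrC subrK.
Qed.

Lemma bouquet_zero_free_chromatic_poly (R : numDomainType) :
  zero_free_chromatic_poly R bouquet = 'X.
Proof.
rewrite (zero_free_chromatic_polyE R E_rep _ bouquet_has_chromatic_poly) //.
rewrite /zero_free_sum (eq_bigl (pred1 fset0)); last first.
  by move=> A; apply/asboolP/eqP => /bouquet_balanced.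
rewrite -big_filter filter_fpowerset0 big_seq1.
by rewrite cardfs0 expr0 scale1r bouquet_nb_balanced_components eqxx.
Qed.

End Bouquet.

(** * Evaluations, and their failure on one-vertex graphs *)

Section Evaluations.
Variables (R : numDomainType) (G : groupType) (Q : finType) (act : Q -> G -> Q).
Hypothesis act_right : is_right_action act.

Lemma chromatic_poly_evaluation (q0 : Q) :
  (forall g, g <> 1%g -> Fix act g = [set q0]) ->
  is_evaluation (nb_frustrated act) has_chromatic_poly
    (chromatic_poly R) #|Q|%:R.
Proof.
move=> fix_q0 Phi has_poly.
have [F Frep FE] := exists_representatives has_poly.
rewrite (chromatic_polyE R Frep FE has_poly).
apply: nb_frustrated_chromatic_sum fix_q0 => // s e.
exact: representatives_satisfied.
Qed.

Lemma zero_free_chromatic_poly_evaluation :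
  (forall g, Fix act g !=set0 -> g = 1%g) ->
  is_evaluation (nb_frustrated act) has_chromatic_poly
    (zero_free_chromatic_poly R) #|Q|%:R.
Proof.
move=> act_free Phi has_poly.
have [F Frep FE] := exists_representatives has_poly.
rewrite (zero_free_chromatic_polyE R Frep FE has_poly).
apply: nb_frustrated_zero_free_sum act_free => // s e.
exact: representatives_satisfied.
Qed.

Lemma nb_frustrated_void (g : void -> G) : nb_frustrated act (bouquet g) = #|Q|.
Proof.
rewrite nb_frustrated_bouquet //; apply: eq_card => q; rewrite inE.
by apply/forallP => -[].
Qed.

(** The vertex without loops has polynomial ['X] and all [#|Q|] states are totally frustrated. *)
Lemma chromatic_poly_evaluation_point (lambda0 : R) :
  is_evaluation (nb_frustrated act) has_chromatic_poly
    (chromatic_poly R) lambda0 -> lambda0 = #|Q|%:R.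
Proof.
move=> eval_chi; pose g0 (x : void) : G := match x with end.
rewrite -(nb_frustrated_void g0) (eval_chi _ (bouquet_has_chromatic_poly g0)).
by rewrite bouquet_chromatic_poly ?card_void ?subr0 ?hornerX // => -[].
Qed.

(** Two loops with gains [g] and [h] have polynomial ['X - 1], so all spins but one are frustrated
    on both loops. The case [g = h] is included. *)
Lemma chromatic_poly_evaluation_fixed (lambda0 : R) (g h : G) :
  is_evaluation (nb_frustrated act) has_chromatic_poly
    (chromatic_poly R) lambda0 -> g <> 1%g -> h <> 1%g ->
  exists q0, forall q, ((act q g == q) || (act q h == q)) = (q == q0).
Proof.
move=> eval_chi g1 h1; pose gh (b : bool) := if b then g else h.
have gh1 b : gh b <> 1%g by case: b.
have := eval_chi _ (bouquet_has_chromatic_poly gh).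
rewrite bouquet_chromatic_poly // card_bool !hornerE.
rewrite (chromatic_poly_evaluation_point eval_chi).
move=> /eqP; rewrite eq_sym subr_eq natr1 eqr_nat -addn1.
rewrite nb_frustrated_bouquet //.
rewrite -(cardC [pred q | [forall b, act q (gh b) != q]]).
rewrite eqn_add2l => /eqP/mem_card1[q0 Eq0]; exists q0 => q.
have := Eq0 q; rewrite !inE => <-; rewrite negb_forall.
apply/orP/existsP => [[] qE|[[]]]; last 2 first.
- by rewrite negbK; left.
- by rewrite negbK; right.
- by exists true; rewrite negbK.
- by exists false; rewrite negbK.
Qed.

(** The pairs [g, g] and [h, h] each give a unique fixed spin; the pair [g, h] has only one spin
    fixed by either, so the two coincide. *)
Lemma not_chromatic_poly_evaluation :
  (0 < #|Q|)%N \/ (exists g : G, g <> 1%g) ->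
  ~ (exists q0 : Q, forall g : G, g <> 1%g -> Fix act g = [set q0]) ->
  ~ exists lambda0 : R,
      is_evaluation (nb_frustrated act) has_chromatic_poly
        (chromatic_poly R) lambda0.
Proof.
move=> nondegenerate no_q0 [lambda0 eval_chi]; apply: no_q0.
(* For a trivial group any spin serves as [q0], and [nondegenerate] supplies one. *)
have [[g g1]|trivG] := pselect (exists g : G, g <> 1%g); last first.
  case: nondegenerate => // /card_gt0P[q0 _]; exists q0 => g g1.
  by case: trivG; exists g.
have [q0 fix_g] := chromatic_poly_evaluation_fixed eval_chi g1 g1.
exists q0 => h h1.
have [q1 fix_gh] := chromatic_poly_evaluation_fixed eval_chi g1 h1.
have [q2 fix_h] := chromatic_poly_evaluation_fixed eval_chi h1 h1.
have E01 : q0 = q1.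
  apply/eqP; rewrite -fix_gh; apply/orP; left.
  by have := fix_g q0; rewrite orbb => ->.
have E21 : q2 = q1.
  apply/eqP; rewrite -fix_gh; apply/orP; right.
  by have := fix_h q2; rewrite orbb => ->.
apply/seteqP; split=> q /=; have := fix_h q; rewrite orbb E21 -E01 => Eq.
  by move=> /eqP; rewrite Eq => /eqP.
by move=> ->; apply/eqP; have := fix_h q0; rewrite orbb E21 -E01 eqxx.
Qed.

Lemma nb_frustrated_loop_lt (g : G) (q : Q) : act q g = q ->
  (nb_frustrated act (bouquet (fun _ : unit => g)) < #|Q|)%N.
Proof.
move=> qg; rewrite nb_frustrated_bouquet //.
rewrite -[ltnRHS](cardC [pred q | [forall i : unit, act q g != q]]).
rewrite -[ltnLHS]addn0 ltn_add2l; apply/card_gt0P; exists q; rewrite !inE.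
by apply/negP => /forallP/(_ tt)/eqP.
Qed.

(** Adding a loop of nontrivial gain [g] to the single vertex keeps the polynomial ['X], but lowers
    the count when [g] fixes a spin. *)
Lemma not_zero_free_chromatic_poly_evaluation :
  ~ (forall g, Fix act g !=set0 -> g = 1%g) ->
  ~ exists lambda0 : R,
      is_evaluation (nb_frustrated act) has_chromatic_poly
        (zero_free_chromatic_poly R) lambda0.
Proof.
move=> /existsNP[g /not_implyP[[q qg] g1]] [lambda0 eval_chi].
pose g0 (x : void) : G := match x with end.
have := eval_chi _ (bouquet_has_chromatic_poly g0).
have := eval_chi _ (bouquet_has_chromatic_poly (fun _ : unit => g)).
rewrite !bouquet_zero_free_chromatic_poly ?nb_frustrated_void //.
move=> <- /eqP; rewrite eqr_nat => /eqP E.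
by have := nb_frustrated_loop_lt qg; rewrite E ltnn.
Qed.

Lemma graph_chromatic_poly_evaluation :
  (forall g : G, Fix act g = [set: Q]) ->
  is_evaluation (nb_frustrated act) (fun=> True)
    (fun Phi => graph_chromatic_poly R (underlying Phi)) #|Q|%:R.
Proof.
move=> act_trivial Phi _.
rewrite graph_chromatic_polyP nb_frustrated_trivial_act //.
by move=> q g; have : [set: Q] q by []; rewrite -(act_trivial g).
Qed.

(** The vertex without loops forces [lambda0] to be [#|Q|]. A loop of gain [g] admits no proper
    coloring, so no spin is frustrated on it and [g] fixes all of [Q]. *)
Lemma not_graph_chromatic_poly_evaluation :
  ~ (forall g : G, Fix act g = [set: Q]) ->
  ~ exists lambda0 : R,
      is_evaluation (nb_frustrated act) (fun=> True)
        (fun Phi => graph_chromatic_poly R (underlying Phi)) lambda0.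
Proof.
move=> nontrivial [lambda0 eval_chi]; apply: nontrivial => g.
pose g0 (x : void) : G := match x with end.
have chi_void : graph_chromatic_poly R (bouquet g0) = 'X.
  apply: (@poly_eq_on_nat _ id) => // k; rewrite graph_chromatic_polyP hornerX.
  rewrite (@ncard_pred _ _ predT); last by move=> s; split=> // _ [].
  by rewrite card_ffun card_unit card_ord.
have lambdaE : lambda0 = #|Q|%:R.
  rewrite -(nb_frustrated_void g0) (eval_chi (bouquet g0) I).
  by rewrite chi_void hornerX.
have := eval_chi (bouquet (fun _ : unit => g)) I.
rewrite lambdaE graph_chromatic_polyP (@ncard_pred _ _ pred0); last first.
  by move=> s; split=> // /(_ tt).
rewrite card0 nb_frustrated_bouquet // => /eqP.
rewrite eqr_nat => /eqP/card0_eq N0.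
apply/seteqP; split=> // q _; apply/eqP; have := N0 q; rewrite !inE.
by move=> /negbT; rewrite negb_forall => /existsP[_]; rewrite negbK.
Qed.

End Evaluations.

Theorem theorem2 (R : numDomainType) (G : groupType) (Q : finType)
    (act : Q -> G -> Q) (act_right : is_right_action act) :
  (* (a); the degenerate case where Q is empty and G trivial is excluded from
     the negative half, which is false there *)
  ((exists q0 : Q, forall g : G, g <> 1%g -> Fix act g = [set q0]) ->
     is_evaluation (nb_frustrated act) has_chromatic_poly
       (chromatic_poly R) #|Q|%:R)
  /\
  ((0 < #|Q|)%N \/ (exists g : G, g <> 1%g) ->
   ~ (exists q0 : Q, forall g : G, g <> 1%g -> Fix act g = [set q0]) ->
     ~ exists lambda0 : R,
         is_evaluation (nb_frustrated act) has_chromatic_poly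
           (chromatic_poly R) lambda0)
  /\
  (* (b) *)
  ((forall g : G, Fix act g !=set0 -> g = 1%g) ->
     is_evaluation (nb_frustrated act) has_chromatic_poly
       (zero_free_chromatic_poly R) #|Q|%:R)
  /\
  (~ (forall g : G, Fix act g !=set0 -> g = 1%g) ->
     ~ exists lambda0 : R,
         is_evaluation (nb_frustrated act) has_chromatic_poly
           (zero_free_chromatic_poly R) lambda0)
  /\
  (* (c) *)
  ((forall g : G, Fix act g = [set: Q]) ->
     is_evaluation (nb_frustrated act) (fun=> True)
       (fun Phi => graph_chromatic_poly R (underlying Phi)) #|Q|%:R)
  /\
  (~ (forall g : G, Fix act g = [set: Q]) ->
     ~ exists lambda0 : R,
         is_evaluation (nb_frustrated act) (fun=> True)
           (fun Phi => graph_chromatic_poly R (underlying Phi)) lambda0).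
Proof.
split; first by case=> q0; exact: chromatic_poly_evaluation.
split; first exact: not_chromatic_poly_evaluation.
split; first exact: zero_free_chromatic_poly_evaluation.
split; first exact: not_zero_free_chromatic_poly_evaluation.
split; first exact: graph_chromatic_poly_evaluation.
exact: not_graph_chromatic_poly_evaluation.
Qed.
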